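(* Let $k \geq 2$ be an integer and suppose that $\theta$ is a primitive element of the finite field $\mathbb{F}_q$ of order $q=p^n$ ($p$ prime, $n \ge 1$) with $q \equiv 1 \bmod 2k$. Then the generalized Paley graph $\mathcal{P}(q, k)$ is disconnected if and only if the field extension $\mathbb{F}_p(\theta^k)$ of $\mathbb{F}_p$ is a proper subfield of $\mathbb{F}_q$. Furthermore, if $\mathcal{P}(q, k)$ is disconnected, then each connected component is isomorphic to the generalized Paley graph $\mathcal{P}(p^a, k')$ with $$k' = \frac{\vert \mathbb{F}_p(\theta^k)^{\times} \vert}{\vert (\mathbb{F}_q^{\times})^k \vert} \geq 1,$$ where $a < n$ is the degree of the extension $\mathbb{F}_p(\theta^k)$ over $\mathbb{F}_p$.
   Context: For an integer $k\ge 1$ and a finite field $\mathbb{F}_q$ of order $q=p^n$, let $(\mathbb{F}_q^{\times})^k=\{\alpha\in\mathbb{F}_q^\times \mid \alpha=\beta^k \text{ for some } \beta\in\mathbb{F}_q^\times\}$. If $q \equiv 1 \bmod 2k$, the generalized Paley graph $\mathcal{P}(q,k)$ is the simple undirected graph with vertex set $\mathbb{F}_q$ in which $x,y$ are adjacent if and only if $x-y\in(\mathbb{F}_q^\times)^k$. (The congruence guarantees $q$ is odd and $-1\in(\mathbb{F}_q^\times)^k$.) The case $k=1$ is allowed for $\mathcal{P}(p^a,k')$: $\mathcal{P}(q,1)$ is the complete graph $K_q$. A primitive element of $\mathbb{F}_q$ is a generator of the cyclic group $\mathbb{F}_q^\times$. *)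

(* Defs.v *)
From HB Require Import structures.
From mathcomp Require Import all_boot all_order all_fingroup all_algebra.
From mathcomp Require Import cyclic vector falgebra fieldext finfield.

Set Implicit Arguments.
Unset Strict Implicit.
Unset Printing Implicit Defensive.

Import GRing.Theory.
Local Open Scope ring_scope.

Record sgraph := SGraph {
  vertex :> finType;
  adj : rel vertex;
  adj_sym : symmetric adj;
  adj_irrefl : irreflexive adj
}.

Definition connected (G : sgraph) : Prop :=
  forall x y : G, connect (@adj G) x y.

Definition component (G : sgraph) (x : G) : {set G} :=
  [set y | connect (@adj G) x y].

Definition induced (G : sgraph) (A : {set G}) : sgraph :=
  @SGraph {x : G | x \in A} (fun u v => adj (val u) (val v))
    (fun u v => adj_sym (val u) (val v)) (fun u => adj_irrefl (val u)).

Definition isomorphic (G H : sgraph) : Prop :=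
  exists2 f : G -> H, bijective f & {mono f : x y / adj x y}.

Definition kth_powers (F : finFieldType) (k : nat) : {set F} :=
  [set b ^+ k | b : F & b != 0].

Definition gpaley_rel (F : finFieldType) (k : nat) : rel F :=
  [rel x y | x - y \in kth_powers F k].
Arguments gpaley_rel : clear implicits.

Lemma kth_powersN1 (F : finFieldType) (k : nat) :
  #|F| = 1 %[mod 2 * k] -> -1 \in kth_powers F k.
Proof.
move=> Fk.
have q_gt1 : (1 < #|F|)%N := finNzRing_gt1 F.
have /dvdnP[m Dm] : (2 * k %| #|F|.-1)%N.
  by rewrite -subn1 -eqn_mod_dvd ?(ltnW q_gt1) //; apply/eqP.
have m_gt0 : (0 < m * k)%N.
  rewrite lt0n; apply/eqP => mk0.
  by have := q_gt1; rewrite -(ltn_predK q_gt1) Dm mulnCA mk0 muln0.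
have /cyclicP[g Dg] := field_unit_group_cyclic [set: {unit F}].
have og : #[g]%g = (m * k * 2)%N.
  by rewrite orderE -Dg card_finField_unit Dm mulnC -mulnA mulnC (mulnC k).
apply/imsetP; exists (val g ^+ m); first by rewrite inE -unitfE unitrX ?(valP g).
have gX j : val (g ^+ j)%g = val g ^+ j by rewrite FinRing.val_unitX.
have : (val g ^+ (m * k)) ^+ 2 == 1.
  by rewrite -exprM -gX -og expg_order.
rewrite sqrf_eq1 => /orP[]/eqP E; last by rewrite exprM in E.
have : (g ^+ (m * k))%g == 1%g by apply/eqP/val_inj; rewrite /= -E -gX.
rewrite -order_dvdn og => /dvdn_leq.
by move/(_ m_gt0); rewrite -{2}[(m * k)%N]muln1 leq_pmul2l.
Qed.

Lemma gpaley_sym (F : finFieldType) (k : nat) :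
  #|F| = 1 %[mod 2 * k] -> symmetric (gpaley_rel F k).
Proof.
move=> /kth_powersN1; rewrite /kth_powers => /imsetP[c]; rewrite inE => c0 Dc.
suff sub x y : gpaley_rel F k x y -> gpaley_rel F k y x.
  by move=> x y; apply/idP/idP; apply: sub.
rewrite /gpaley_rel /= /kth_powers => /imsetP[b]; rewrite inE => b0 Db.
apply/imsetP; exists (c * b); first by rewrite inE mulf_neq0.
by rewrite exprMn -Dc -Db mulN1r opprB.
Qed.

Lemma gpaley_irrefl (F : finFieldType) (k : nat) :
  irreflexive (gpaley_rel F k).
Proof.
move=> x; rewrite /gpaley_rel /= subrr; apply/imsetP => -[b]; rewrite inE.
by move=> b0 /esym/eqP; rewrite expf_eq0 (negPf b0) andbF.
Qed.

(* The congruence forces 0 < k, since 1 < #|F|. *)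
Definition gpaley (F : finFieldType) (k : nat)
    (Fk : #|F| = 1 %[mod 2 * k]) : sgraph :=
  SGraph (gpaley_sym Fk) (@gpaley_irrefl F k).

Definition primitive_element (F : finFieldType) (theta : {unit F}) : bool :=
  generator [set: {unit F}] theta.

(* pPrimeCharType charFp is F itself, viewed as a field extension of 'F_p. *)
Definition Fp_adjoin (F : finFieldType) (p : nat) (charFp : p \in [pchar F])
    (x : F) : {subfield pPrimeCharType charFp} :=
  <<1; (x : pPrimeCharType charFp)>>%AS.

(* Main.v *)
(** Let S be the group of nonzero k-th powers and K = F_p(theta^k). As S consists
    of the powers of theta^k, every element of K = F_p[theta^k] is a sum of
    elements of S, so x and y are connected exactly when x - y is in K, and the
    component of x is the coset x + K. Being the subgroup of order s = #|S| of a
    cyclic group, S is the set of solutions of z^s = 1, and so is the set of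
    k'-th powers in any field E with #|K| elements, since k' s = #|K| - 1. Hence
    any field isomorphism f from K to E gives the graph isomorphism
    u |-> f (u - x). *)
Require Import Defs.
From HB Require Import structures.
From mathcomp Require Import all_boot all_order all_fingroup all_algebra.
From mathcomp Require Import cyclic vector falgebra fieldext finfield.

Set Implicit Arguments.
Unset Strict Implicit.
Unset Printing Implicit Defensive.

Import GRing.Theory.
Local Open Scope ring_scope.

(** * The cyclic group of nonzero [k]-th powers *)

Section KthPowers.
Variables (F : finFieldType) (theta : {unit F}).
Hypothesis theta_prim : primitive_element theta.

Let cycle_theta : [set: {unit F}] = <[theta]>%g := eqP theta_prim.

Lemma order_primitive_element : #[theta]%g = #|F|.-1.
Proof. by rewrite -card_finField_unit cycle_theta. Qed.

Lemma primitive_elementX (x : F) : x != 0 -> exists i, x = val theta ^+ i.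
Proof.
move=> x0; have : finField_unit x0 \in [set: {unit F}] by rewrite inE.
rewrite cycle_theta => /cycleP[i Di].
by exists i; rewrite -FinRing.val_unitX -Di.
Qed.

Lemma kth_powers_primitive k :
  kth_powers F k = [set val u | u in <[theta ^+ k]>%g].
Proof.
apply/setP=> x; apply/imsetP/imsetP=> [[b] | [u /cycleP[i ->] ->]].
  rewrite inE => /primitive_elementX[i ->] ->.
  exists ((theta ^+ k) ^+ i)%g; first exact: mem_cycle.
  by rewrite !FinRing.val_unitX exprAC.
exists (val theta ^+ i); first by rewrite inE -unitfE unitrX ?(valP theta).
by rewrite !FinRing.val_unitX exprAC.
Qed.

Lemma card_kth_powers_primitive k : (k %| #|F|.-1)%N ->
  #|kth_powers F k| = (#|F|.-1 %/ k)%N.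
Proof.
move=> kdv; rewrite kth_powers_primitive card_imset; last exact: val_inj.
by rewrite -orderE orderXdiv order_primitive_element.
Qed.
End KthPowers.

(** This frees the facts below from a given primitive element, so that the membership criterion also
    applies to the field [E] of the theorem. *)
Lemma exists_primitive_element (F : finFieldType) :
  exists theta : {unit F}, primitive_element theta.
Proof.
have /cyclicP[g Dg] := field_unit_group_cyclic [set: {unit F}].
by exists g; rewrite /primitive_element /generator Dg.
Qed.

Lemma card_kth_powers (F : finFieldType) k : (k %| #|F|.-1)%N ->
  #|kth_powers F k| = (#|F|.-1 %/ k)%N.
Proof.
have [g g_prim] := exists_primitive_element F.
exact: (card_kth_powers_primitive g_prim).
Qed.

(** With [N = #|F|.-1], a power [g ^+ i] of a generator solves the equation iff [N] divides
    [i * (N %/ k)], that is, iff [k] divides [i]. *)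
Lemma mem_kth_powers (F : finFieldType) k (x : F) : (k %| #|F|.-1)%N ->
  (x \in kth_powers F k) = (x ^+ (#|F|.-1 %/ k) == 1).
Proof.
move=> kdv; have [g g_prim] := exists_primitive_element F.
have q_gt1 := finNzRing_gt1 F.
have N_gt0 : (0 < #|F|.-1)%N by rewrite -ltnS (ltn_predK q_gt1).
(* Positivity matters twice: it excludes [x = 0], as [0 ^+ 0 = 1], and it lets this exponent be
   cancelled in the divisibility below. *)
have s_gt0 : (0 < #|F|.-1 %/ k)%N.
  by rewrite divn_gt0; [exact: dvdn_leq | exact: dvdn_gt0 kdv].
apply/idP/eqP=> [|xs1].
  rewrite (kth_powers_primitive g_prim) => /imsetP[u /cycleP[i ->] ->].
  rewrite -FinRing.val_unitX -!expgM mulnCA (mulnC k) divnK //.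
  by rewrite -(order_primitive_element g_prim) mulnC expgM expg_order expg1n.
have x0 : x != 0.
  by apply: contra_eq_neq xs1 => ->; rewrite expr0n gtn_eqF // eq_sym oner_eq0.
have [i Dx] := primitive_elementX g_prim x0.
have : (g ^+ (i * (#|F|.-1 %/ k)) == 1)%g.
  by apply/eqP/val_inj; rewrite FinRing.val_unitX exprM -Dx.
rewrite -order_dvdn order_primitive_element // -{1}(divnK kdv) mulnC.
rewrite dvdn_pmul2r // => /dvdnP[j Di].
apply/imsetP; exists (val g ^+ j); last by rewrite -exprM -Di.
by rewrite inE -unitfE unitrX ?(valP g).
Qed.

(** * Embedding a simple extension into another field *)

(* Evaluation at x identifies <<1; x>> with F0[X] modulo m, so evaluation at y
   factors through it. *)
Lemma adjoin_embedding (F0 : fieldType) (L M : fieldExtType F0) (x : L) (y : M)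
    (m : {poly F0}) :
    minPoly 1 x = map_poly (in_alg L) m -> root (map_poly (in_alg M) m) y ->
  exists f : L -> M,
    [/\ {in <<1; x>>%VS &, {morph f : u v / u - v}},
        {in <<1; x>>%VS, forall u n, f (u ^+ n) = f u ^+ n}
      & {in <<1; x>>%VS &, injective f}].
Proof.
move=> Dm my0; have lift v : {q | Fadjoin_poly 1 x v = map_poly (in_alg L) q}.
  exact/sig_eqW/polyOver1P/Fadjoin_polyOver.
pose ev q := (map_poly (in_alg M) q).[y].
pose f v := ev (sval (lift v)).
(* Independence of the chosen lift: polynomials with the same value at [x] differ by a multiple of
   [m], which vanishes at [y]. *)
have ev_f q : f (map_poly (in_alg L) q).[x] = ev q.
  rewrite /f; case: (lift _) => r /= Dr; apply/eqP; rewrite -subr_eq0 /ev.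
  rewrite -hornerN -hornerD -!rmorphB /=.
  suff /dvdpP[s ->] : m %| r - q by rewrite rmorphM hornerM (rootP my0) mulr0.
  rewrite -(dvdp_map (in_alg L)) -Dm; apply: minPoly_dvdp.
    by apply/polyOver1P; exists (r - q).
  rewrite /root rmorphB hornerD hornerN /= -Dr Fadjoin_poly_eq ?subrr //.
  by apply: mempx_Fadjoin; apply/polyOver1P; exists q.
have K_ev v : v \in <<1; x>>%VS -> exists q, v = (map_poly (in_alg L) q).[x].
  by move=> /Fadjoin_polyP[_ /polyOver1P[q ->] ->]; exists q.
have fB : {in <<1; x>>%VS &, {morph f : u v / u - v}}.
  move=> u v /K_ev[q ->] /K_ev[r ->].
  by rewrite -hornerN -hornerD -rmorphB !ev_f /ev rmorphB hornerD hornerN.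
have fM : {in <<1; x>>%VS &, {morph f : u v / u * v}}.
  move=> u v /K_ev[q ->] /K_ev[r ->].
  by rewrite -hornerM -rmorphM !ev_f /ev rmorphM hornerM.
have f1 : f 1 = 1.
  by have := ev_f 1; rewrite /ev !rmorph1 !hornerC.
exists f; split=> //.
  move=> u Ku; elim=> [|n IHn]; first by rewrite !expr0.
  by rewrite !exprS fM ?IHn // (rpredX n Ku).
(* Otherwise [u - v] is invertible in [<<1; x>>] while [f] kills it, forcing [f 1 = 0]. *)
move=> u v Ku Kv fuv; apply/eqP; rewrite -subr_eq0; apply/negPn/negP => nz.
have Kuv : u - v \in <<1; x>>%AS by rewrite rpredB.
have := fM (u - v) (u - v)^-1 Kuv.
rewrite memvV => /(_ Kuv); rewrite fB // fuv subrr mul0r divff // f1.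
by move/eqP; rewrite oner_eq0.
Qed.

(* The minimal polynomial divides X^#|E| - X, which splits in E. *)
Lemma finField_root_minPoly (E : finFieldType) (F0 : finFieldType)
  (L : fieldExtType F0) (x : L) (iota : {rmorphism F0 -> E}) (m : {poly F0}) :
    #|E| = (#|F0| ^ \dim <<1; x>>)%N ->
    minPoly 1 x = map_poly (in_alg L) m ->
  exists y, root (map_poly iota m) y.
Proof.
move=> cardE Dm.
(* Divisibility is checked over [L], where [x ^+ #|E| = x]; it descends to [F0] and is then carried
   to [E] by [iota]. *)
have : m %| 'X^#|E| - 'X.
  rewrite -(dvdp_map (in_alg L)) -Dm; apply: minPoly_dvdp.
    by apply/polyOver1P; exists ('X^#|E| - 'X).
  rewrite rmorphB /= map_polyXn map_polyX /root !hornerE subr_eq0 cardE.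
  by rewrite -Fermat's_little_theorem memv_adjoin.
rewrite -(dvdp_map iota) rmorphB /= map_polyXn map_polyX finField_genPoly.
case/dvdp_prod_XsubC=> mm; set r := mask _ _ => Er.
(* Being nonconstant, the divisor retains at least one linear factor. *)
have : (1 < size (map_poly iota m))%N.
  rewrite size_map_poly -(size_map_poly (in_alg L)) -Dm.
  by rewrite size_minPoly.
rewrite (eqp_size Er) size_prod_XsubC; case: r Er => //= y r Er _.
by exists y; rewrite (eqp_root Er) big_cons rootM root_XsubC eqxx.
Qed.

Lemma dvdn_pred_cardF (F : finFieldType) k :
  #|F| = 1 %[mod 2 * k] -> (2 * k %| #|F|.-1)%N.
Proof.
have q_gt1 := finNzRing_gt1 F.
by move/eqP; rewrite eqn_mod_dvd ?subn1 // ltnW.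
Qed.

(** * Connected components as cosets of [K] *)

Section Connectivity.
Variables (F : finFieldType) (p : nat) (charF : p \in [pchar F]).
Variables (theta : {unit F}) (theta_prim : primitive_element theta) (k : nat).
Let w : pPrimeCharType charF := val theta ^+ k.
Let K := Fp_adjoin charF (val theta ^+ k).

Lemma kth_powers_Fp_adjoin (x : F) : x \in kth_powers F k -> x \in K.
Proof.
rewrite (kth_powers_primitive theta_prim) => /imsetP[u /cycleP[i ->] ->].
rewrite !FinRing.val_unitX.
by rewrite (rpredX i (memv_adjoin 1 w)).
Qed.

Lemma connect_gpaley_rel (x y : F) :
  connect (gpaley_rel F k) x y = (x - y \in K).
Proof.
apply/idP/idP=> [/connectP[s] | Kxy].
  elim: s x => [|z s IHs] x /= => [_ -> | /andP[Sxz /IHs{}IHs /IHs Kzy]].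
    by rewrite subrr; apply: (mem0v K).
  rewrite -(subrKA z); apply: (@memvD _ _ K) => //.
  exact: kth_powers_Fp_adjoin.
(* Subtracting such a [z] never leaves a component. This is stable under sums, so it suffices to
   treat the terms of a polynomial in [w]. *)
pose P (z : F) := forall u, connect (gpaley_rel F k) u (u - z).
suff /(_ x) : P (x - y) by rewrite opprB addrC subrK.
have PD : forall z1 z2, P z1 -> P z2 -> P (z1 + z2).
  move=> z1 z2 P1 P2 u; rewrite opprD addrA.
  exact: connect_trans (P1 u) (P2 _).
have P0 : P 0 by move=> u; rewrite subr0.
have /Fadjoin_polyP[_ /polyOver1P[q ->] ->] := Kxy.
rewrite horner_coef; apply: (big_ind P) => // i _.
rewrite coef_map /=.
(* A scalar of ['F_p] acts as a natural number, so each term is a repeated sum of the [k]-th power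
   [w ^+ i]. *)
have -> : (q`_i)%:A * w ^+ i = w ^+ i *+ (q`_i)%R.
  by rewrite -scalerAl mul1r -mulr_natl.
elim: (nat_of_ord (q`_i)%R) => [|j IHj]; first exact: P0.
rewrite mulrS; apply: PD => // u; apply: connect1.
rewrite /gpaley_rel /= opprB addrC subrK (kth_powers_primitive theta_prim).
apply/imsetP; exists ((theta ^+ k) ^+ i)%g; first exact: mem_cycle.
by rewrite !FinRing.val_unitX.
Qed.

End Connectivity.

(** As [k'] is a truncated quotient, its exactness is a separate conclusion. Any field [E] with
    [p ^ a] elements may serve as the field of that order, and the congruence its Paley graph
    requires is part of the conclusion. *)
Theorem theorem1p2 (F : finFieldType) (p n k : nat)
    (p_pr : prime p) (n_gt0 : (1 <= n)%N) (cardF : #|F| = (p ^ n)%N)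
    (k_ge2 : (2 <= k)%N) (Fk : #|F| = 1 %[mod 2 * k])
    (theta : {unit F}) (theta_prim : primitive_element theta) :
  let G := gpaley Fk in
  let K := Fp_adjoin (card_finPcharP cardF p_pr) (val theta ^+ k) in
  let a := \dim K in
  let Kunits := [set x in K | x != 0] in
  let k' := (#|Kunits| %/ #|kth_powers F k|)%N in
  (~ connected G <-> K != fullv :> {vspace _}) /\
  (~ connected G ->
    [/\ (a < n)%N,
        (#|kth_powers F k| %| #|Kunits|)%N,
        (1 <= k')%N
      & forall E : finFieldType, #|E| = (p ^ a)%N ->
          exists Ek' : #|E| = 1 %[mod 2 * k'],
          forall x : G, isomorphic (induced (component x)) (gpaley Ek')]).
Proof.
move=> G K a Kunits k'.
pose charF := card_finPcharP cardF p_pr.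
pose w : pPrimeCharType charF := val theta ^+ k.
have connectE x y : connect (@adj G) x y = (x - y \in K).
  exact: connect_gpaley_rel.
have disconnectedE : ~ connected G <-> K != fullv :> {vspace _}.
  split=> [nconn | /eqP nK conn].
    apply: contra_notN nconn => /eqP Kfull x y.
    rewrite connectE; have := memvf (x - y : pPrimeCharType charF).
    by rewrite -Kfull.
  apply: nK; apply/vspaceP => z; rewrite memvf.
  by rewrite -[z]subr0; have := conn z 0; rewrite connectE.
split=> // /disconnectedE nK.
set s := #|kth_powers F k|.
have dv2k := dvdn_pred_cardF Fk.
have dvk : (k %| #|F|.-1)%N := dvdn_trans (dvdn_mull 2 (dvdnn k)) dv2k.
have Ds : s = (#|F|.-1 %/ k)%N := card_kth_powers dvk.
(* Evenness of [s] gives the congruence modulo [2 * k'], since [#|E|.-1 = k' * s]. *)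
have dv2s : (2 %| s)%N by rewrite Ds dvdn_divRL.
have s_gt0 : (0 < s)%N.
  rewrite lt0n; apply/eqP => /cards0_eq S0.
  by have := kth_powersN1 Fk; rewrite S0 inE.
have memS x : (x \in kth_powers F k) = (x ^+ s == 1).
  by rewrite mem_kth_powers // -Ds.
have cardK : #|[set x in K]| = (p ^ a)%N.
  by rewrite cardsE card_vspace card_Fp.
have cardKu : #|Kunits| = (p ^ a).-1.
  rewrite -cardK (cardsD1 0 [set x in K]) inE mem0v /=.
  by apply: eq_card => x; rewrite !inE andbC.
(* The order of [theta ^+ k] is [s], and as a nonzero element of a field with [p ^ a] elements it
   satisfies [w ^+ (p ^ a).-1 = 1]. *)
have dvs : (s %| #|Kunits|)%N.
  have -> : s = #[theta ^+ k]%g.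
    by rewrite orderXdiv (order_primitive_element theta_prim).
  rewrite order_dvdn; apply/eqP/val_inj; rewrite !FinRing.val_unitX cardKu.
  have w0 : w != 0 by rewrite expf_neq0 // -unitfE (valP theta).
  apply: (mulfI w0); rewrite -exprS prednK ?expn_gt0 ?prime_gt0 // mulr1.
  have := Fermat's_little_theorem K w.
  by rewrite memv_adjoin card_Fp // => /esym/eqP.
have k'_gt0 : (0 < k')%N.
  rewrite divn_gt0 // dvdn_leq // card_gt0; apply/set0Pn; exists 1.
  by rewrite inE rpred1 oner_neq0.
split=> //.
  rewrite -(ltn_exp2l _ _ (prime_gt1 p_pr)) -cardF -cardK ltnNge.
  apply: contra nK => leFK; apply/eqP/vspaceP=> z; rewrite memvf.
  have /eqP/setP/(_ z) : [set x in K] == [set: F].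
    by rewrite eqEcard subsetT cardsT.
  by rewrite !inE.
move=> E cardE.
have DKu : (k' * s)%N = #|E|.-1 by rewrite cardE -cardKu divnK.
have Ek' : #|E| = 1 %[mod 2 * k'].
  apply/eqP; rewrite eqn_mod_dvd ?subn1 -?DKu; last exact: ltnW (finNzRing_gt1 E).
  by rewrite mulnC dvdn_pmul2l.
exists Ek' => x.
pose charE := card_finPcharP cardE p_pr.
have /polyOver1P[m Dm] := minPolyOver 1 w.
have [y my0] : exists y, root (map_poly (in_alg (pPrimeCharType charE)) m) y.
  by apply: finField_root_minPoly Dm; rewrite card_Fp.
have [f [fB fX fI]] := adjoin_embedding Dm my0.
have Kx (u : induced (component x)) : val u - x \in K.
  have := valP u; rewrite inE connectE => Kxu.
  by rewrite -opprB; apply: etrans (memvN K _) _.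
(* The power law at exponent 0, read on [0 ^+ 0 = 1]. *)
have f1 : f 1 = 1 by rewrite -(expr0 0) fX ?expr0 // mem0v.
exists (fun u : induced (component x) => f (val u - x)); last first.
  move=> u v /=; rewrite /gpaley_rel /= memS.
  have dvk' : (k' %| #|E|.-1)%N by rewrite -DKu dvdn_mulr.
  (* The exponent [#|E|.-1 %/ k'] is again [s]: both adjacencies ask whether the [s]-th power of a
     difference is 1, which [f] preserves and, by injectivity on [K], reflects. *)
  rewrite mem_kth_powers // -DKu mulKn //.
  have Duv : val u - val v = (val u - x) - (val v - x).
    by rewrite opprB addrA subrK.
  have Kuv : val u - val v \in K by rewrite Duv; apply: (@memvB _ _ K).
  have -> : f (val u - x) - f (val v - x) = f (val u - val v).
    by rewrite Duv; apply/esym/fB; apply: Kx.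
  rewrite -fX // -f1; apply: (inj_in_eq fI); first exact: (rpredX s Kuv).
  exact: mem1v.
(* Surjectivity by counting: [E] has as many elements as [K], and translation by [x] injects [K]
   into the component. *)
apply: inj_card_bij => [u v /(fI _ _ (Kx u) (Kx v))/addIr/val_inj //|].
rewrite cardE -cardK card_sig.
rewrite -(card_imset _ (addrI x)); apply/subset_leq_card/subsetP=> z.
case/imsetP=> v; rewrite inE => Kv ->; rewrite !inE connectE.
by rewrite opprD addNKr; apply: etrans (memvN K _) _.
Qed.
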